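(* Let $f:A\to B$ be a ring homomorphism. Assume that $A$ is a local ring with finitely generated maximal ideal $M$ satisfying $f(M)B=B$. Then, for every ideal $J$ of $B$ contained in the Jacobson radical of $B$, the amalgamation $A\bowtie^f J$ is a local ring with finitely generated maximal ideal, and $\mathrm{embdim}(A)=\mathrm{embdim}(A\bowtie^f J)$.
   Context: All rings are commutative with unity; ''local'' means having exactly one maximal ideal. $A\bowtie^f J:=\{(a,f(a)+j)\mid a\in A,\ j\in J\}$ is a subring of $A\times B$. $f(M)B$ is the ideal of $B$ generated by $f(M)$. For a local ring $R$ with finitely generated maximal ideal $N$, $\mathrm{embdim}(R)$ is the minimum number of generators of $N$, i.e. $\dim_{R/N}(N/N^2)$. *)

(* Defs.v *)
From HB Require Import structures.
From mathcomp Require Import all_boot all_order all_algebra.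
From mathcomp Require Import boolp classical_sets.

Set Implicit Arguments.
Unset Strict Implicit.
Unset Printing Implicit Defensive.

Import GRing.Theory.

Local Open Scope classical_set_scope.
Local Open Scope ring_scope.

(* Rings are [comPzRingType]s, so that the zero ring is allowed (it has no     *)
(* maximal ideal).  The ideals of MathComp's [ring_quotient] are proper by     *)
(* definition and live in nonzero rings, hence the definitions below.          *)

Section Ideals.
Variable R : comPzRingType.

Definition is_ideal (I : set R) : Prop :=
  [/\ I 0, forall x y, I x -> I y -> I (x + y) & forall a x, I x -> I (a * x)].

Record ideal := Ideal { ideal_set :> set R; idealP : is_ideal ideal_set }.

Definition maximal_ideal (N : set R) : Prop :=
  [/\ is_ideal N, N <> [set: R] &
      forall I : set R, is_ideal I -> N `<=` I -> I = N \/ I = [set: R]].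

Definition jacobson_radical : set R :=
  \bigcap_(N in [set N | maximal_ideal N]) N.

Definition ideal_gen (S : set R) : set R := smallest is_ideal S.

Definition generated_by (n : nat) (I : set R) : Prop :=
  exists2 s : seq R, size s = n & I = ideal_gen [set` s].

Definition fin_gen (I : set R) : Prop := exists n, generated_by n I.

(* The value is 0 when [I] is not finitely generated. *)
Definition min_gens (I : set R) : nat :=
  xget 0%N [set n | generated_by n I /\
                    forall m, generated_by m I -> (n <= m)%N].

End Ideals.

Arguments jacobson_radical R : clear implicits.

Definition local (R : comPzRingType) : Prop :=
  exists! N : set R, maximal_ideal N.

(* Only meaningful when [R] is local, in which case the chosen maximal ideal   *)
(* is the unique one.                                                          *)
Definition embdim (R : comPzRingType) : nat :=
  min_gens (xget set0 [set N : set R | maximal_ideal N]).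

Section Amalgamation.
Variables (A B : comPzRingType) (f : {rmorphism A -> B}) (J : ideal B).

Definition amalg_set : set (A * B) :=
  [set (a, f a + j) | a in [set: A] & j in (J : set B)].

Definition amalg : Type := {x : A * B | x \in amalg_set}.

Lemma amalg_subring : subring_closed (fun x : A * B => x \in amalg_set).
Proof.
have [J0 JD JM] := idealP J.
have JN j : ideal_set J j -> ideal_set J (- j).
  by move=> Jj; rewrite -mulN1r; apply: JM.
split.
- rewrite -topredE /=; apply/mem_set; exists 1 => //; exists 0 => //.
  by rewrite rmorph1 addr0.
- move=> x y /set_mem[a _ [j Jj <-]] /set_mem[b _ [k Jk <-]].
  rewrite -topredE /=; apply/mem_set; exists (a - b) => //.
  exists (j - k); first by apply: JD => //; apply: JN.
  by congr pair; rewrite rmorphB /= opprD addrACA.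
- move=> x y /set_mem[a _ [j Jj <-]] /set_mem[b _ [k Jk <-]].
  rewrite -topredE /=; apply/mem_set; exists (a * b) => //.
  exists (f a * k + j * (f b + k)).
    by apply: JD; [apply: JM | rewrite mulrC; apply: JM].
  by congr pair; rewrite rmorphM /= addrA -mulrDr -mulrDl.
Qed.

HB.instance Definition _ := SubChoice.on amalg.
HB.instance Definition _ :=
  GRing.SubChoice_isSubComPzRing.Build (A * B)%type
    (fun x => x \in amalg_set) amalg amalg_subring.

End Amalgamation.

(* Main.v *)
Require Import Defs.
From HB Require Import structures.
From mathcomp Require Import all_boot all_order all_algebra.
From mathcomp Require Import boolp classical_sets.

(** Write [R] for the amalgamation, [pi : R -> A] for the first projection and
    [N] for the preimage of [M] under [pi].

    [R] is local with maximal ideal [N]: an element [(a, f a + j)] of [R]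
    outside [N] has [a] invertible in the local ring [A], and then
    [f a + j = f a * (1 + f (a^-1) * j)] is invertible in [B] because [j] lies
    in the Jacobson radical; the inverse is again in [R]
    ([amalg_invertible], [maximal_ideal_unique]).

    For the generators, the condition [f(M)B = B] makes the kernel [0 x J] of
    [pi] superfluous.  If [m_1, ..., m_n] generate [M] and [1] is the sum of the
    [f m_i * b_i], then for [j] in [J] the pair [(0, j)] is the sum of the
    products [(m_i, f m_i) * (0, b_i * j)].  Hence the [(m_i, f m_i)] already
    generate [N] ([amalg_ideal_gen_diag]).  Conversely the projections of
    generators of [N] generate [M].  So for each [n], [N] has [n] generators if
    and only if [M] has ([generated_by_amalg]), which gives both finite
    generation of [N] and equality of the minimal numbers of generators. *)

Import GRing.Theory.

Local Open Scope classical_set_scope.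
Local Open Scope ring_scope.

(** * Ideals and generators *)

Section IdealTheory.
Context {R : comPzRingType}.

Lemma ideal_full (I : set R) : is_ideal I -> I 1 -> I = [set: R].
Proof.
move=> [_ _ IM] I1; apply/seteqP; split=> x // _.
by rewrite -[x]mulr1; apply: IM.
Qed.

Lemma maximal_ideal_not1 (N : set R) : maximal_ideal N -> ~ N 1.
Proof. by move=> [idN NT _] /(ideal_full _ idN). Qed.

Lemma is_ideal_gen (S : set R) : is_ideal (ideal_gen S).
Proof.
split=> [I [[]] //|x y Sx Sy I HI|a x Sx I HI]; have [[_ ID IM] _] := HI.
  by apply: ID; [apply: Sx | apply: Sy].
by apply: IM; apply: Sx.
Qed.

Lemma is_ideal_preimage {R' : comPzRingType} (g : {rmorphism R -> R'})
    (I : set R') : is_ideal I -> is_ideal (g @^-1` I).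
Proof.
move=> [I0 ID IM]; split=> [|x y|a x] /=; rewrite ?rmorph0 ?rmorphD ?rmorphM //.
  exact: ID.
exact: IM.
Qed.

Lemma is_ideal_principal (x : R) : is_ideal (range (fun a => a * x)).
Proof.
split=> [|_ _ [a _ <-] [b _ <-]|a _ [b _ <-]].
- by exists 0; rewrite ?mul0r.
- by exists (a + b); rewrite ?mulrDl.
- by exists (a * b); rewrite ?mulrA.
Qed.

(** Krull's theorem. *)
Lemma exists_maximal_ideal (I : set R) : is_ideal I -> ~ I 1 ->
  exists2 N, maximal_ideal N & I `<=` N.
Proof.
move=> idI I1; have [I0 ID IM] := idI.
(* Joining [I] to every member keeps the empty chain, whose union is the empty
   set, inside the family to which Zorn's lemma is applied. *)
pose P := [set X : set R | is_ideal (X `|` I) /\ ~ (X `|` I) 1].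
have [F FP Ftot|X [[idX X1] Xmax]] := @Zorn_bigcup R P.
  split; last by move=> [[X FX X1]|//]; have [_] := FP X FX; apply; left.
  split; first by right.
  - have DU X x y : F X -> X x -> (X `|` I) y ->
        (\bigcup_(Y in F) Y `|` I) (x + y).
      move=> FX Xx Xy; have [[_ XD _] _] := FP X FX.
      by have [] := XD x y (or_introl Xx) Xy; [left; exists X | right].
    move=> x y [[X FX Xx]|Ix] [[Y FY Yy]|Iy].
    + have [XY|YX] := Ftot X Y FX FY.
        by apply: (DU Y) => //; [apply: XY | left].
      by apply: (DU X) => //; left; apply: YX.
    + by apply: (DU X) => //; right.
    + by rewrite addrC; apply: (DU Y) => //; right.
    + by right; apply: ID.
  - move=> a x [[X FX Xx]|Ix]; last by right; apply: IM.
    have [[_ _ XM] _] := FP X FX.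
    by have [] := XM a x (or_introl Xx); [left; exists X | right].
exists (X `|` I); last by move=> x Ix; right.
split=> // [XT|K idK XK]; first by apply: X1; rewrite XT.
have [K1|K1] := pselect (K 1); first by right; apply: ideal_full.
have KI : K `|` I = K by apply/setUidPl => x Ix; apply: XK; right.
have PK : P K by split; rewrite KI.
left; apply/seteqP; split=> [x Kx|x]; last exact: XK.
have [Xx|Xx] := pselect (X x); first by left.
exfalso; apply: (Xmax K) => //; split=> [y Xy|KX]; first by apply: XK; left.
by apply: Xx; apply: KX.
Qed.

Lemma invertible_of_maximal (x : R) :
  (forall N, maximal_ideal N -> ~ N x) -> exists y, y * x = 1.
Proof.
move=> xN; apply: contrapT => xV.
have [[y _ yx]|N Nmax xN'] := exists_maximal_ideal _ (is_ideal_principal x).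
  by apply: xV; exists y.
by apply: (xN N Nmax); apply: xN'; exists 1; rewrite ?mul1r.
Qed.

(** A maximal ideal containing both [j] and [1 + j] would contain [1]. *)
Lemma jacobson_invertible (j : R) :
  jacobson_radical R j -> exists y, y * (1 + j) = 1.
Proof.
move=> Jj; apply: invertible_of_maximal => N Nmax Nj1.
have [[_ ND NM] _ _] := Nmax; apply: (maximal_ideal_not1 _ Nmax).
have -> : 1 = (1 + j) + -1 * j :> R by rewrite mulN1r addrK.
by apply: (ND _ _ Nj1); apply: NM; apply: Jj.
Qed.

Lemma local_invertible (M : set R) (a : R) :
  local R -> maximal_ideal M -> ~ M a -> exists y, y * a = 1.
Proof.
move=> [P [_ Puniq]] Mmax Ma; apply: invertible_of_maximal => N Nmax.
by rewrite -(Puniq N Nmax) (Puniq M Mmax).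
Qed.

(** A proper ideal contains no invertible element, so all of them, maximal or
    not, lie inside [N]. *)
Lemma maximal_ideal_unique (N : set R) : is_ideal N -> ~ N 1 ->
  (forall x, ~ N x -> exists y, y * x = 1) ->
  forall P, maximal_ideal P <-> P = N.
Proof.
move=> idN N1 NV.
have sub P : is_ideal P -> ~ P 1 -> P `<=` N.
  move=> [_ _ PM] P1 x Px; apply: contrapT => /NV[y yx].
  by apply: P1; rewrite -yx; apply: PM.
move=> P; split=> [Pmax|->].
  have [idP _ PM] := Pmax.
  have [//|NT] := PM N idN (sub P idP (maximal_ideal_not1 _ Pmax)).
  by case: N1; rewrite NT.
split=> // [NT|I idI NI]; first by apply: N1; rewrite NT.
have [I1|I1] := pselect (I 1); first by right; apply: ideal_full.
by left; apply/seteqP; split; [apply: sub|].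
Qed.

Lemma embdim_local (M : set R) :
  local R -> maximal_ideal M -> embdim R = min_gens M.
Proof.
move=> [P [_ Puniq]] Mmax; congr min_gens.
by apply: xget_unique => // N Nmax; rewrite -(Puniq N Nmax) (Puniq M Mmax).
Qed.

End IdealTheory.

Lemma eq_min_gens (R R' : comPzRingType) (I : set R) (I' : set R') :
  (forall n, generated_by n I <-> generated_by n I') ->
  min_gens I = min_gens I'.
Proof.
move=> II'; rewrite /min_gens; congr xget; apply/seteqP; split=> n /= [In Imin].
  by split=> [|m Im]; [apply/II' | apply/Imin/II'].
by split=> [|m Im]; [apply/II' | apply/Imin/II'].
Qed.

(** * The amalgamation *)

Section AmalgamationTheory.
Context {A B : comPzRingType} (f : {rmorphism A -> B}) (J : ideal B).
Local Notation R := (amalg f J).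

(** Bundling [val] as a morphism lets one rewriting rule cover it throughout. *)
Definition amalg_val : {rmorphism R -> A * B} := (val : R -> A * B).

Lemma amalg_val_inj : injective amalg_val.
Proof. exact: val_inj. Qed.

Definition amalg_fst : {rmorphism R -> A} := fst \o amalg_val.

(** Membership in the amalgamation no longer mentions an existential witness:
    the element [j] is determined by the pair. *)
Lemma mem_amalg_set (x : A * B) :
  (x \in amalg_set f J) <-> (J : set B) (x.2 - f x.1).
Proof.
split=> [/set_mem[a _ [j Jj <-]] /=|Jx]; first by rewrite addrC addKr.
apply/mem_set; exists x.1 => //; exists (x.2 - f x.1) => //.
by rewrite addrC subrK -surjective_pairing.
Qed.

Lemma amalg_lift (x : A * B) :
  (J : set B) (x.2 - f x.1) -> exists z : R, amalg_val z = x.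
Proof. by move=> /mem_amalg_set xP; exists (Sub x xP); apply: SubK. Qed.

Lemma amalg_val_ideal (x : R) :
  (J : set B) ((amalg_val x).2 - f (amalg_val x).1).
Proof. exact/mem_amalg_set/(valP x). Qed.

Lemma mem_amalg_diag (a : A) : (a, f a) \in amalg_set f J.
Proof. by apply/mem_amalg_set; rewrite subrr; have [] := idealP J. Qed.

Definition amalg_diag (a : A) : R := Sub (a, f a) (mem_amalg_diag a).

Lemma amalg_val_diag a : amalg_val (amalg_diag a) = (a, f a).
Proof. exact: SubK. Qed.

Lemma amalg_diagK : cancel amalg_diag amalg_fst.
Proof. by move=> a; rewrite -[LHS]/(amalg_val _).1 amalg_val_diag. Qed.

Lemma amalg_diag_zmod_morphism : zmod_morphism amalg_diag.
Proof.
by move=> a b; apply: amalg_val_inj; rewrite rmorphB !amalg_val_diag rmorphB.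
Qed.

Lemma amalg_diag_monoid_morphism : monoid_morphism amalg_diag.
Proof.
split=> [|a b]; apply: amalg_val_inj; first by rewrite amalg_val_diag !rmorph1.
by rewrite rmorphM !amalg_val_diag rmorphM.
Qed.

HB.instance Definition _ :=
  GRing.isZmodMorphism.Build A R amalg_diag amalg_diag_zmod_morphism.
HB.instance Definition _ :=
  GRing.isMonoidMorphism.Build A R amalg_diag amalg_diag_monoid_morphism.

(** If [a] inverts the first component and [u] inverts [1 + f a * j], the
    inverse is [(a, u * f a)]; it lies in the amalgamation because
    [u * f a - f a = (u - 1) * f a] and [u - 1 = - u * f a * j] is in [J]. *)
Lemma amalg_invertible (x : R) : J `<=` jacobson_radical B ->
  (exists a, a * (amalg_val x).1 = 1) -> exists y, y * x = 1.
Proof.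
move=> J_jac [a ax]; have [_ _ JM] := idealP J.
set b := (amalg_val x).2; set j := b - f (amalg_val x).1.
have Jj : (J : set B) (f a * j) by apply: JM; apply: amalg_val_ideal.
have fab : f a * b = 1 + f a * j.
  by rewrite /j mulrBr -rmorphM ax rmorph1 addrC subrK.
have [u u1] := jacobson_invertible _ (J_jac _ Jj).
have [|y yE] := amalg_lift (a, u * f a).
  rewrite /=; have -> : u * f a - f a = (- (u * f a)) * (f a * j).
    rewrite -{2}[f a]mul1r -u1 mulrDr mulr1 -mulrBl opprD addrA subrr add0r.
    by rewrite !mulNr mulrAC.
  exact: JM.
exists y; apply: amalg_val_inj.
rewrite rmorphM rmorph1 yE [amalg_val x]surjective_pairing.
by congr pair; rewrite //= -mulrA fab.
Qed.

(** The set of [b] in [B] such that [(0, b * j)] lies in the ideal [I] for all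
    [j] in [J] is an ideal of [B]; it contains [f(M)], since
    [(0, f m * j) = (m, f m) * (0, j)], and hence it contains [1].  So [I]
    contains [0 x J], and an element over [m] in [M] differs from [(m, f m)]
    by an element of [0 x J]. *)
Lemma amalg_ideal_gen_diag (M : set A) (I : set R) :
  ideal_gen (f @` M) = [set: B] -> is_ideal I ->
  (forall m, M m -> I (amalg_diag m)) -> amalg_fst @^-1` M `<=` I.
Proof.
move=> fMB [I0 ID IM] IMdiag x Mx; have [_ _ JM] := idealP J.
pose K := [set b |
  forall (z : R) j, (J : set B) j -> amalg_val z = (0, b * j) -> I z].
have idK : is_ideal K.
  split=> [z j _ zE|b c Kb Kc z j Jj zE|a b Kb z j Jj zE].
  - suff -> : z = 0 by [].
    by apply: amalg_val_inj; rewrite zE mul0r rmorph0.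
  - have [|zb zbE] := amalg_lift (0, b * j).
      by rewrite /= rmorph0 subr0; apply: JM.
    have [|zc zcE] := amalg_lift (0, c * j).
      by rewrite /= rmorph0 subr0; apply: JM.
    have -> : z = zb + zc.
      apply: amalg_val_inj; rewrite rmorphD zbE zcE zE.
      by congr pair; rewrite /= ?addr0 ?mulrDl.
    by apply: ID; [apply: (Kb zb j)|apply: (Kc zc j)].
  - apply: (Kb z (a * j)); first exact: JM.
    by rewrite zE mulrCA mulrA.
have K1 : K 1.
  have : ideal_gen (f @` M) 1 by rewrite fMB.
  apply: smallest_sub => // _ [m Mm <-] z j Jj zE.
  have [|zj zjE] := amalg_lift (0, j); first by rewrite /= rmorph0 subr0.
  have -> : z = zj * amalg_diag m.
    apply: amalg_val_inj; rewrite rmorphM zjE amalg_val_diag zE.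
    by congr pair; rewrite /= ?mul0r 1?mulrC.
  by apply: IM; apply: IMdiag.
rewrite -[x](subrK (amalg_diag (amalg_fst x))); apply: ID; last exact: IMdiag.
apply: (K1 _ ((amalg_val x).2 - f (amalg_val x).1)).
  exact: amalg_val_ideal.
rewrite rmorphB amalg_val_diag [amalg_val x in LHS]surjective_pairing mul1r.
by congr pair; rewrite /= subrr.
Qed.

(** Generators lift along the section [amalg_diag] of the projection, and
    descend along the projection. *)
Lemma generated_by_amalg (M : set A) (n : nat) :
  is_ideal M -> ideal_gen (f @` M) = [set: B] ->
  generated_by n M <-> generated_by n (amalg_fst @^-1` M).
Proof.
move=> idM fMB; split=> -[s sn sE].
  exists (map amalg_diag s); first by rewrite size_map.
  apply/seteqP; split; last first.
    apply: smallest_sub; first exact: is_ideal_preimage.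
    move=> _ /mapP[m ms ->]; rewrite /preimage /mkset amalg_diagK sE.
    exact: sub_gen_smallest.
  apply: amalg_ideal_gen_diag => //; first exact: is_ideal_gen.
  rewrite sE; apply: smallest_sub.
    exact: (is_ideal_preimage amalg_diag _ (is_ideal_gen _)).
  by move=> m ms; apply: sub_gen_smallest; apply: map_f.
exists (map amalg_fst s); first by rewrite size_map.
apply/seteqP; split; last first.
  apply: smallest_sub => // _ /mapP[x xs ->].
  suff : (amalg_fst @^-1` M) x by [].
  by rewrite sE; apply: sub_gen_smallest.
move=> m Mm.
have : (amalg_fst @^-1` M) (amalg_diag m).
  by rewrite /preimage /mkset amalg_diagK.
rewrite sE -[X in _ -> ideal_gen _ X]amalg_diagK.
apply: (@smallest_sub _ _ _ (amalg_fst @^-1` ideal_gen [set` map amalg_fst s])).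
  exact: is_ideal_preimage (is_ideal_gen _).
by move=> x xs; apply: sub_gen_smallest; apply: map_f.
Qed.

End AmalgamationTheory.

Theorem proposition4p3 (A B : comPzRingType) (f : {rmorphism A -> B})
    (M : set A) (A_local : local A) (M_max : maximal_ideal M)
    (M_fg : fin_gen M) (fMB : ideal_gen (f @` M) = [set: B])
    (J : ideal B) (J_jac : J `<=` jacobson_radical B) :
  [/\ local (amalg f J),
      exists2 N : set (amalg f J), maximal_ideal N & fin_gen N &
      embdim A = embdim (amalg f J)].
Proof.
have [idM _ _] := M_max.
pose N : set (amalg f J) := amalg_fst f J @^-1` M.
have N_iff : forall P, maximal_ideal P <-> P = N.
  apply: maximal_ideal_unique => [||x Nx].
  - exact: is_ideal_preimage.
  - by rewrite /N /preimage /mkset rmorph1; apply: maximal_ideal_not1.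
  - by apply: amalg_invertible => //; apply: (local_invertible M).
have N_max : maximal_ideal N by apply/N_iff.
have R_local : local (amalg f J) by exists N; split=> // P /N_iff.
have gens n : generated_by n M <-> generated_by n N.
  exact: generated_by_amalg.
split=> //; first by exists N => //; have [n /gens] := M_fg; exists n.
by rewrite (embdim_local M) // (embdim_local N) //; apply: eq_min_gens.
Qed.
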